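(* Let $\mathbf t=t_0t_1\cdots=01101001\cdots$ be the Thue--Morse word (fixed point of $0\mapsto01$, $1\mapsto10$), and for $i\ge0$ let $A(i,m,n)=(t_{i+k+\ell})_{0\le k<m,0\le\ell<n}$, with $|A(i,m,n)|_1$ its number of $1$ entries. Suppose $m,n\ge3$. Then $\max_{i,j\ge0}\big||A(i,m,n)|_1-|A(j,m,n)|_1\big|=3$ if and only if $m$ and $n$ are both odd. *)

(* Defs.v *)
From mathcomp Require Import all_boot all_order all_algebra.

Set Implicit Arguments.
Unset Strict Implicit.
Unset Printing Implicit Defensive.

(* The alphabet {0, 1} is bool, with false for 0 and true for 1. *)
Definition tm_letter (a : bool) : seq bool :=
  if a then [:: true; false] else [:: false; true].

Definition tm_morphism (w : seq bool) : seq bool := flatten (map tm_letter w).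

(* The fixed point beginning with 0 is the limit of the iterates of the        *)
(* morphism on the word 0: each iterate is a prefix of the next one, and the   *)
(* n-th one has length 2 ^ n > n, hence already contains the letter t_n. See   *)
(* thue_morse0 and thue_morse_fixed below.                                     *)
Definition thue_morse (n : nat) : bool :=
  nth false (iter n tm_morphism [:: false]) n.

Definition hankel_tm (i m n : nat) : 'M[bool]_(m, n) :=
  \matrix_(k < m, l < n) thue_morse (i + k + l).

Definition count_ones (m n : nat) (A : 'M[bool]_(m, n)) : nat :=
  #|[set p : 'I_m * 'I_n | A p.1 p.2 == true]|.

Definition is_max2 (f : nat -> nat -> nat) (M : nat) : Prop :=
  (exists i j : nat, f i j = M) /\ (forall i j : nat, f i j <= M).

Lemma tm_morphism_cat u v :
  tm_morphism (u ++ v) = tm_morphism u ++ tm_morphism v.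
Proof. by rewrite /tm_morphism map_cat flatten_cat. Qed.

Lemma size_tm_morphism w : size (tm_morphism w) = (size w).*2.
Proof. by elim: w => //= -[] w IHw /=; rewrite IHw. Qed.

Lemma size_tm_iter n : size (iter n tm_morphism [:: false]) = 2 ^ n.
Proof. by elim: n => //= n IHn; rewrite size_tm_morphism IHn expnS mul2n. Qed.

Lemma tm_iter_cat n d :
  exists v, iter (n + d) tm_morphism [:: false]
            = iter n tm_morphism [:: false] ++ v.
Proof.
have step k : exists v, iter k.+1 tm_morphism [:: false]
                        = iter k tm_morphism [:: false] ++ v.
  elim: k => [|k [v IHk]]; first by exists [:: true].
  by exists (tm_morphism v); rewrite iterS {1}IHk tm_morphism_cat.
elim: d => [|d [v IHd]]; first by exists [::]; rewrite addn0 cats0.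
have [v' Hv'] := step (n + d).
by exists (v ++ v'); rewrite addnS Hv' IHd catA.
Qed.

Lemma nth_tm_iter n i :
  i < 2 ^ n -> nth false (iter n tm_morphism [:: false]) i = thue_morse i.
Proof.
move=> lt_i; rewrite /thue_morse.
have [v1 E1] := tm_iter_cat n i; have [v2 E2] := tm_iter_cat i n.
have := congr1 (fun w => nth false w i) E1.
rewrite nth_cat size_tm_iter lt_i => <-.
by rewrite addnC E2 nth_cat size_tm_iter ltn_expl.
Qed.

Lemma thue_morse0 : thue_morse 0 = false.
Proof. by []. Qed.

Lemma thue_morse_fixed n :
  tm_morphism (mkseq thue_morse n) = mkseq thue_morse n.*2.
Proof.
have pref k N : k <= 2 ^ N ->
    mkseq thue_morse k = take k (iter N tm_morphism [:: false]).
  move=> le_k; apply: (@eq_from_nth _ false) => [|i].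
    by rewrite size_mkseq size_takel // size_tm_iter.
  rewrite size_mkseq => lt_i; rewrite nth_mkseq // nth_take // nth_tm_iter //.
  exact: leq_trans le_k.
have le_n : n <= 2 ^ n by apply: ltnW; rewrite ltn_expl.
rewrite (pref n n) // (pref n.*2 n.+1); last by rewrite expnS mul2n leq_double.
rewrite iterS -{2}(cat_take_drop n (iter n _ _)) tm_morphism_cat.
by rewrite take_size_cat // size_tm_morphism size_takel // size_tm_iter.
Qed.

(* Main.v *)
Require Import Defs.
From mathcomp Require Import all_boot all_order all_algebra.
From mathcomp Require Import zify.

Set Implicit Arguments.
Unset Strict Implicit.
Unset Printing Implicit Defensive.

(** Write s = (-1)^t. Since s (2k) + s (2k+1) = 0, the partial sums of s are
    P (2k) = 0 and P (2k+1) = s k, and the partial sums of P at x are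
    Q x = P (x/2). Hence the sum S i of the signs in the i-th Hankel block is
    Q (i+n+m) - Q (i+n) - Q (i+m) + Q i, while t (2^N + k) = ~~ t k for k < 2^N
    gives for every i some j with S j = - S i. If mn is even, each |S i| is
    the even number of ones by which blocks i and j differ, so a maximum of 3
    would force |S i| <= 2 and all differences to be at most 2. If m and n are
    odd, an odd number of the four Q's vanish, so |S i| <= 3; equality amounts
    to finding q for which t q, t (q+x), t (q+y) have a prescribed
    non-constant pattern, which a descent by halving x and y provides. *)

Import GRing.Theory.

Local Notation t := thue_morse.

(** * Doubling and complement rules for [t] *)

Lemma nth_tm_morphism w i :
  i < size w ->
  nth false (tm_morphism w) i.*2 = nth false w i /\
  nth false (tm_morphism w) i.*2.+1 = ~~ nth false w i.
Proof.
elim: w i => //= a w IHw [|i] /=; first by case: a.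
by rewrite ltnS => /IHw; case: a.
Qed.

Lemma thue_morse_double_pair i : t i.*2 = t i /\ t i.*2.+1 = ~~ t i.
Proof.
have lt_i : i < size (mkseq t i.+1) by rewrite size_mkseq.
have := nth_tm_morphism lt_i; rewrite thue_morse_fixed.
by rewrite !nth_mkseq //; lia.
Qed.

Lemma thue_morse_double i : t i.*2 = t i.
Proof. by have [] := thue_morse_double_pair i. Qed.

Lemma thue_morse_doubleS i : t i.*2.+1 = ~~ t i.
Proof. by have [] := thue_morse_double_pair i. Qed.

Lemma thue_morse_compl N k : k < 2 ^ N -> t (2 ^ N + k) = ~~ t k.
Proof.
elim: N k => [|N IHN] k; first by case: k.
rewrite expnS => lt_k; have lt_k2 : k./2 < 2 ^ N by lia.
rewrite -(odd_double_half k); case: (odd k); rewrite /= ?add1n ?add0n.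
  have -> : 2 * 2 ^ N + k./2.*2.+1 = (2 ^ N + k./2).*2.+1 by lia.
  by rewrite !thue_morse_doubleS IHN.
have -> : 2 * 2 ^ N + k./2.*2 = (2 ^ N + k./2).*2 by lia.
by rewrite !thue_morse_double IHN.
Qed.

(** * Three-letter patterns at prescribed distances *)

Definition tm_pattern (b c : bool) (x y : nat) : Prop :=
  exists q, t (q + x) = t q (+) b /\ t (q + y) = t q (+) c.

Lemma tm_pattern_even b c x y :
  tm_pattern b c x y -> tm_pattern b c x.*2 y.*2.
Proof.
by case=> q [Hx Hy]; exists q.*2; rewrite -!doubleD !thue_morse_double.
Qed.

(** The alternatives are the two parities of the new position: an odd position produces a carry in
    [x]. Either way only one of the two letters at distance [x] is complemented by the morphism, so
    [b] flips. *)
Lemma tm_pattern_odd_even b c x y :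
  tm_pattern (~~ b) c x y \/ tm_pattern (~~ b) c x.+1 y ->
  tm_pattern b c x.*2.+1 y.*2.
Proof.
case=> -[q [Hx Hy]].
  exists q.*2; rewrite addnS -!doubleD thue_morse_doubleS !thue_morse_double.
  by rewrite Hx Hy; case: b {Hx}; case: (t q).
exists q.*2.+1; rewrite addSnnS -doubleS addSn -!doubleD.
rewrite !thue_morse_doubleS thue_morse_double Hx Hy.
by case: b c {Hx Hy} => -[]; case: (t q).
Qed.

Lemma tm_patternC b c x y : tm_pattern b c x y -> tm_pattern c b y x.
Proof. by case=> q [Hx Hy]; exists q. Qed.

Lemma tm_pattern_odd b c x y :
  tm_pattern (~~ b) (~~ c) x y \/ tm_pattern (~~ b) (~~ c) x.+1 y.+1 ->
  tm_pattern b c x.*2.+1 y.*2.+1.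
Proof.
case=> -[q [Hx Hy]].
  exists q.*2; rewrite !addnS -!doubleD !thue_morse_doubleS thue_morse_double.
  by rewrite Hx Hy; case: b c {Hx Hy} => -[]; case: (t q).
exists q.*2.+1; rewrite !addSnnS -!doubleS -!doubleD.
rewrite thue_morse_doubleS !thue_morse_double Hx Hy.
by case: b c {Hx Hy} => -[]; case: (t q).
Qed.

(** The pairs at which the descent stops: each alternative for the halves has a zero distance, equal
    distances, or one twice the other. *)
Lemma tm_pattern_small b c x y :
  (x, y) \in [:: (1, 3); (1, 4); (2, 3); (3, 4)] -> tm_pattern b c x y.
Proof.
have/allP H : all (fun p => has (fun q =>
    (t (q + p.1) == t q (+) b) && (t (q + p.2) == t q (+) c)) (iota 0 8))
    [:: (1, 3); (1, 4); (2, 3); (3, 4)].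
  by case: b; case: c; vm_compute.
by move=> /H /hasP[q _ /andP[/eqP Hx /eqP Hy]]; exists q.
Qed.

(** Constant patterns are excluded for y = 2x because t contains no cube, so
    that t q, t (q+1), t (q+2) are never equal. *)
Lemma tm_pattern_exists b c x y :
  0 < x < y -> [|| b, c | y != x.*2] -> tm_pattern b c x y.
Proof.
elim/ltn_ind: y b c x => y IH b c x xy ok.
have IH' b' c' x' y' :
  y' < y -> 0 < x' < y' -> y' != x'.*2 -> tm_pattern b' c' x' y'.
  by move=> lt_y xy' ne; apply: IH => //; rewrite ne !orbT.
have [[x' Ex] | [x' Ex]] : (exists x', x = x'.*2) \/ (exists x', x = x'.*2.+1).
- by case: (boolP (odd x)) => ox; [right | left]; exists x./2; lia.
all: have [[y' Ey] | [y' Ey]] :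
    (exists y', y = y'.*2) \/ (exists y', y = y'.*2.+1)
  by case: (boolP (odd y)) => oy; [right | left]; exists y./2; lia.
all: subst x y.
- by apply/tm_pattern_even/IH; lia.
- have [[-> ->] | x1] : x' = 1 /\ y' = 1 \/ ~ (x' = 1 /\ y' = 1) by lia.
    exact: tm_pattern_small.
  apply/tm_patternC/tm_pattern_odd_even.
  (* If the halved pair is degenerate, the pair with carry is not, the small cases being
     excluded. *)
  case: (boolP ((x' < y') && (y' != x'.*2))) => h; [left | right];
    apply/tm_patternC/IH'; lia.
- have [[Ex Ey] | x1] : x' = 0 /\ y' = 1 \/ ~ (x' = 0 /\ y' = 1) by lia.
    (* The pair (1, 2), where the constant pattern would be a cube. *)
    have {ok} : b || c by lia.
    rewrite {}Ex {}Ey {xy IH IH'}.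
    by case: b c => -[] // _; [exists 0 | exists 3 | exists 1].
  have [[-> ->] | x2] : x' = 0 /\ y' = 2 \/ ~ (x' = 0 /\ y' = 2) by lia.
    exact: tm_pattern_small.
  have [[-> ->] | x3] : x' = 1 /\ y' = 2 \/ ~ (x' = 1 /\ y' = 2) by lia.
    exact: tm_pattern_small.
  apply/tm_pattern_odd_even.
  case: (boolP ((0 < x') && (y' != x'.*2))) => h; [left | right];
    apply/IH'; lia.
- have [[-> ->] | x1] : x' = 0 /\ y' = 1 \/ ~ (x' = 0 /\ y' = 1) by lia.
    exact: tm_pattern_small.
  apply/tm_pattern_odd.
  case: (boolP ((0 < x') && (y' != x'.*2))) => h; [left | right];
    apply/IH'; lia.
Qed.

(** * Sign sums of Hankel blocks *)

Section Signs.

Local Open Scope ring_scope.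

Definition tm_sign (k : nat) : int := if t k then -1 else 1.

(** The prefix sum P of the signs, in closed form; [tm_sumS] is its recurrence. *)
Definition tm_sum (x : nat) : int := if odd x then tm_sign x./2 else 0.

Lemma tm_sumS x : tm_sum x.+1 = tm_sum x + tm_sign x.
Proof.
rewrite /tm_sum /tm_sign -{5}(odd_double_half x) /= uphalf_half.
case: (odd x) => /=; rewrite ?add0n ?add1n.
  by rewrite thue_morse_doubleS; case: (t _).
by rewrite thue_morse_double add0r.
Qed.

(** The recurrence of Q: the half moves only at odd x = 2k+1, where P x = s k is also the increment
    of P at k. *)
Lemma tm_sum_halfS x : tm_sum x.+1./2 = tm_sum x./2 + tm_sum x.
Proof.
rewrite /= uphalf_half {3}/tm_sum; case: (odd x); last by rewrite addr0.
by rewrite add1n tm_sumS.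
Qed.

Lemma tm_sum_half4 r j : (j < 4)%N ->
  tm_sum (4 * r + j)./2 = if (j < 2)%N then 0 else tm_sign r.
Proof.
move=> lt_j; case: ifP => lt2.
  have -> : ((4 * r + j)./2 = r.*2)%N by lia.
  by rewrite /tm_sum odd_double.
have -> : ((4 * r + j)./2 = r.*2.+1)%N by lia.
by rewrite /tm_sum /= odd_double uphalf_double.
Qed.

Definition hankel_ones (i m n : nat) : nat := count_ones (hankel_tm i m n).

Lemma hankel_onesE i m n :
  hankel_ones i m n = (\sum_(k < m) \sum_(l < n) t (i + k + l))%N.
Proof.
rewrite pair_bigA /= /hankel_ones /count_ones -sum1dep_card.
rewrite [LHS]big_mkcond; apply: eq_bigr => -[k l] _ /=.
by rewrite mxE; case: (t _).
Qed.

Definition hankel_sign (i m n : nat) : int :=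
  tm_sum (i + m + n)./2 - tm_sum (i + m)./2 - tm_sum (i + n)./2
  + tm_sum i./2.

Lemma row_onesE i n :
  (2 * \sum_(l < n) t (i + l))%N%:Z = n%:Z - (tm_sum (i + n) - tm_sum i).
Proof.
elim: n => [|n IHn]; first by rewrite big_ord0 addn0 subrr.
rewrite big_ord_recr /= addnS tm_sumS mulnDr PoszD IHn /tm_sign.
by case: (t _) => /=; lia.
Qed.

Lemma hankel_ones_sign i m n :
  (2 * hankel_ones i m n)%N%:Z = (m * n)%N%:Z - hankel_sign i m n.
Proof.
rewrite hankel_onesE /hankel_sign.
elim: m => [|m IHm]; first by rewrite big_ord0 !addn0; lia.
rewrite big_ord_recr /= addnS addSn !tm_sum_halfS mulnDr PoszD IHm row_onesE.
lia.
Qed.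

Lemma hankel_ones_compl i m n :
  exists j, (hankel_ones i m n + hankel_ones j m n = m * n)%N.
Proof.
(* The power of 2 exceeds every index in block [i], so the shift complements every entry. *)
exists (2 ^ (i + m + n) + i)%N; rewrite !hankel_onesE -big_split /=.
rewrite (eq_bigr (fun=> n)) => [|k _]; first by rewrite sum_nat_const card_ord.
rewrite -big_split /= (eq_bigr (fun=> 1%N)) => [|l _].
  by rewrite sum_nat_const card_ord muln1.
have lt_N : (i + k + l < 2 ^ (i + m + n))%N.
  apply: leq_ltn_trans (ltn_expl (i + m + n) (isT : 1 < 2)%N).
  by have := ltn_ord k; have := ltn_ord l; lia.
have -> : (2 ^ (i + m + n) + i + k + l = 2 ^ (i + m + n) + (i + k + l))%N.
  by rewrite !addnA.
by rewrite thue_morse_compl //; case: (t _).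
Qed.

Lemma tm_sum_cases x :
  tm_sum x = 0 /\ ~~ odd x \/ (tm_sum x = 1 \/ tm_sum x = -1) /\ odd x.
Proof.
rewrite /tm_sum /tm_sign; case: (odd x); last by left.
by right; split=> //; case: (t _); [right | left].
Qed.

(** Exactly two of the four arguments are odd, so their halves add up to 2i+m+n-1, an odd number.
    Hence some half is even and its term vanishes. *)
Lemma hankel_sign_odd_le i m n :
  odd m -> odd n -> -3 <= hankel_sign i m n <= 3.
Proof.
move=> om on; rewrite /hankel_sign.
have := tm_sum_cases (i + m + n)./2; have := tm_sum_cases (i + m)./2.
have := tm_sum_cases (i + n)./2; have := tm_sum_cases i./2.
lia.
Qed.

Lemma tm_pattern_sign (b c : bool) x y : tm_pattern b c x y ->
  exists q, tm_sign (q + x) = (if b then - tm_sign q else tm_sign q) /\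
            tm_sign (q + y) = (if c then - tm_sign q else tm_sign q).
Proof.
case=> q [Hx Hy]; exists q; rewrite /tm_sign Hx Hy.
by case: b c {Hx Hy} => -[]; case: (t q).
Qed.

Lemma tm_sign_patterns (b c : bool) x y : b || c ->
  (0 < x)%N -> (0 < y)%N -> (x = y -> b = c) ->
  exists q, tm_sign (q + x) = (if b then - tm_sign q else tm_sign q) /\
            tm_sign (q + y) = (if c then - tm_sign q else tm_sign q).
Proof.
move=> bc x0 y0 eq_bc; apply: tm_pattern_sign.
case: (ltngtP x y) => [lt_xy | lt_yx | Exy].
- by apply: tm_pattern_exists; [rewrite x0 | rewrite orbA bc].
- by apply/tm_patternC/tm_pattern_exists; [rewrite y0 | rewrite orbA orbC; lia].
(* Only one condition remains; [x.+1] is a dummy second distance. *)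
have [||q [Hx _]] := @tm_pattern_exists b c x x.+1; try lia.
by exists q; rewrite -Exy -eq_bc.
Qed.

Lemma hankel_sign_odd_max m n :
  odd m -> odd n -> (3 <= m)%N -> (3 <= n)%N ->
  exists i, `|hankel_sign i m n|%N = 3.
Proof.
move=> om on m3 n3.
have sgn k : tm_sign k = 1 \/ tm_sign k = -1.
  by rewrite /tm_sign; case: (t k); [right | left].
(* The residue of [i] modulo 4 is chosen so that exactly one Q vanishes; the other three are signs
   to be aligned. In residue 1, the bound 3 makes [a] or [b] positive. *)
have [a Em] : exists a, m = (4 * a + 1)%N \/ m = (4 * a + 3)%N.
  by exists (m %/ 4)%N; lia.
have [b En] : exists b, n = (4 * b + 1)%N \/ n = (4 * b + 3)%N.
  by exists (n %/ 4)%N; lia.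
case: Em En => [] -> [] -> in m3 n3 *.
- have [||||r [H1 H2]] := @tm_sign_patterns true true a b; try lia.
  exists (4 * r + 2)%N; rewrite /hankel_sign.
  have -> : (4 * r + 2 + (4 * a + 1) + (4 * b + 1) =
             4 * (r + a + b + 1) + 0)%N by lia.
  have -> : (4 * r + 2 + (4 * a + 1) = 4 * (r + a) + 3)%N by lia.
  have -> : (4 * r + 2 + (4 * b + 1) = 4 * (r + b) + 3)%N by lia.
  by rewrite !tm_sum_half4 //= H1 H2; have := sgn r; lia.
- have [||||r [H1 H2]] := @tm_sign_patterns true false a (a + b + 1); try lia.
  exists (4 * r + 2)%N; rewrite /hankel_sign.
  have -> : (4 * r + 2 + (4 * a + 1) + (4 * b + 3) =
             4 * (r + (a + b + 1)) + 2)%N by lia.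
  have -> : (4 * r + 2 + (4 * a + 1) = 4 * (r + a) + 3)%N by lia.
  have -> : (4 * r + 2 + (4 * b + 3) = 4 * (r + b + 1) + 1)%N by lia.
  by rewrite !tm_sum_half4 //= H1 H2; have := sgn r; lia.
- have [||||r [H1 H2]] := @tm_sign_patterns true false b (a + b + 1); try lia.
  exists (4 * r + 2)%N; rewrite /hankel_sign.
  have -> : (4 * r + 2 + (4 * a + 3) + (4 * b + 1) =
             4 * (r + (a + b + 1)) + 2)%N by lia.
  have -> : (4 * r + 2 + (4 * a + 3) = 4 * (r + a + 1) + 1)%N by lia.
  have -> : (4 * r + 2 + (4 * b + 1) = 4 * (r + b) + 3)%N by lia.
  by rewrite !tm_sum_half4 //= H1 H2; have := sgn r; lia.
- have [||||r [H1 H2]] := @tm_sign_patterns true true a.+1 b.+1; try lia.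
  (* Residue 2 would make three of the four terms vanish here. *)
  exists (4 * r + 3)%N; rewrite /hankel_sign.
  have -> : (4 * r + 3 + (4 * a + 3) + (4 * b + 3) =
             4 * (r + a + b + 2) + 1)%N by lia.
  have -> : (4 * r + 3 + (4 * a + 3) = 4 * (r + a.+1) + 2)%N by lia.
  have -> : (4 * r + 3 + (4 * b + 3) = 4 * (r + b.+1) + 2)%N by lia.
  by rewrite !tm_sum_half4 //= H1 H2; have := sgn r; lia.
Qed.

End Signs.

Theorem theorem13 (m n : nat) (hm : 3 <= m) (hn : 3 <= n) :
  is_max2
    (fun i j : nat =>
       `|count_ones (hankel_tm i m n) - count_ones (hankel_tm j m n)|%N) 3
  <-> odd m /\ odd n.
Proof.
rewrite /is_max2 -!/(hankel_ones _ _ _).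
split=> [[[i [j Hij]] Hmax] | [om on]].
- apply/andP; rewrite -oddM; apply: contraT => mn_even.
  have [i' Hi] := hankel_ones_compl i m n.
  have [j' Hj] := hankel_ones_compl j m n.
  have := Hmax i i'; have := Hmax j j'.
  move: Hij Hi Hj mn_even; rewrite -!/(hankel_ones _ _ _).
  move: (m * n) (hankel_ones _ _ _) (hankel_ones _ _ _) => N x y.
  move: (hankel_ones _ _ _) (hankel_ones _ _ _) => x' y'; lia.
split=> [|i j].
  have [i Hi] := hankel_sign_odd_max om on hm hn.
  have [j Hj] := hankel_ones_compl i m n.
  exists i, j; rewrite -!/(hankel_ones _ _ _).
  by have := hankel_ones_sign i m n; lia.
(* Twice the difference of the counts is a difference of two sign sums, hence at most 6. *)
have := hankel_ones_sign i m n; have := hankel_ones_sign j m n.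
have := hankel_sign_odd_le i om on; have := hankel_sign_odd_le j om on.
rewrite -!/(hankel_ones _ _ _); lia.
Qed.
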